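(* Let $A=(a_{ij})\in\mathbb{R}^{2\times 2}$ with $a_{11}>a_{22}$, and set $\alpha_1=\min(a_{12}-a_{11},\,a_{22}-a_{21})$, $\alpha_2=\min(a_{21}-a_{11},\,a_{22}-a_{12})$. Let $T$ be a triangle with vertices $V_{12},V_{21},V_{22}$, and describe points of $T$ by barycentric coordinates with respect to $(V_{12},V_{21},V_{22})$. Consider the points $$\beta_1'=(0,0,1),\quad \beta_2'=\Big(\tfrac{e^{\alpha_1}}{e^{\alpha_1}+1},0,\tfrac{1}{e^{\alpha_1}+1}\Big),\quad \beta_3'=\Big(0,\tfrac{e^{\alpha_2}}{e^{\alpha_2}+1},\tfrac{1}{e^{\alpha_2}+1}\Big),$$ $$\beta_4'=\Big(\tfrac{e^{a_{12}-a_{11}}}{e^{a_{12}-a_{11}}+e^{a_{21}-a_{11}}},\tfrac{e^{a_{21}-a_{11}}}{e^{a_{12}-a_{11}}+e^{a_{21}-a_{11}}},0\Big).$$ Then the three segments $\beta_1'\beta_4'$, $V_{21}\beta_2'$ and $V_{12}\beta_3'$ pass through a common point.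
   Context: Barycentric coordinates: a point $x$ of a triangle with vertices $v_1,v_2,v_3$ is written $x=\phi_1v_1+\phi_2v_2+\phi_3v_3$ with $\phi_i\ge 0$, $\phi_1+\phi_2+\phi_3=1$, where $\phi_i$ equals the area of the subtriangle opposite $v_i$ divided by the area of the triangle; thus $V_{12}=(1,0,0)$, $V_{21}=(0,1,0)$, $V_{22}=(0,0,1)=\beta_1'$. These points arise as normalised exponential images of the scaled extremals $(0,-\infty,-\infty,0)$, $(0,\alpha_1,-\infty,0)$, $(0,-\infty,\alpha_2,0)$, $(0,a_{12}-a_{11},a_{21}-a_{11},-\infty)$ of the tropical cone of matrices commuting with $A$, projected to the coordinates $(b_{12},b_{21},b_{22})$ and mapped by $t\mapsto e^t$ (with $e^{-\infty}=0$) followed by normalisation to sum $1$. *)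

(* Defs.v *)
From mathcomp Require Import all_boot all_order all_algebra.
From mathcomp Require Import all_classical all_reals all_analysis.

Set Implicit Arguments.
Unset Strict Implicit.
Unset Printing Implicit Defensive.

Import Order.TTheory GRing.Theory Num.Theory.

Local Open Scope classical_set_scope.
Local Open Scope ring_scope.
Local Open Scope convex_scope.

(* Affine independence.  The ambient dimension [n] is arbitrary, so that both a
   triangle drawn in the plane and the standard simplex of R^3 are covered. *)
Definition is_triangle (R : realType) (n : nat) (V1 V2 V3 : 'rV[R]_n) : Prop :=
  row_free (col_mx (V2 - V1) (V3 - V1)).

(* The coordinates are absolute, not homogeneous: [(p1, p2, p3)] are the
   barycentric coordinates of this point of the triangle when they are
   nonnegative and sum to 1. *)
Definition bary_point (R : realType) (n : nat) (V1 V2 V3 : 'rV[R]_n)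
    (p1 p2 p3 : R) : 'rV[R]_n :=
  p1 *: V1 + p2 *: V2 + p3 *: V3.

Definition segment (R : realType) (n : nat) (P Q : 'rV[R]_n) : set 'rV[R]_n :=
  [set X | exists t : {i01 R}, X = (P : convex_lmodType 'rV[R]_n) <| t |> Q].

(* Main.v *)
(** Write [p = e^alpha1] and [q = e^alpha2].  Since [alpha1 + a21] and
    [alpha2 + a12] both equal [min (a12 + a21 - a11) a22], we have
    [p / q = e^(a12 - a21)], so the point with homogeneous barycentric
    coordinates [p : q : 1] lies on all three segments. *)
Require Import Defs.
From mathcomp Require Import all_boot all_order all_algebra.
From mathcomp Require Import all_classical all_reals all_analysis.
From mathcomp Require Import ring lra.

Import Order.TTheory GRing.Theory Num.Theory.

Set Implicit Arguments.
Unset Strict Implicit.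
Unset Printing Implicit Defensive.

Local Open Scope classical_set_scope.
Local Open Scope ring_scope.

(** The weight in [P <| t |> Q] falls on the first endpoint [P], so this holds by conversion once
    [w] is packed as an element of [{i01 R}]. *)
Lemma segment_combination (R : realType) (n : nat) (P Q : 'rV[R]_n) (w : R) :
  0 <= w <= 1 -> segment P Q (w *: P + (1 - w) *: Q).
Proof.
by move=> /andP[w0 w1]; exists (Itv01 w0 w1).
Qed.

(** [bary_point] is linear in its three coefficients, so membership in a segment reduces to scalar
    identities, one per coordinate. *)
Lemma segment_bary_point (R : realType) (n : nat) (V1 V2 V3 : 'rV[R]_n)
    (w p1 p2 p3 q1 q2 q3 : R) :
  0 <= w <= 1 ->
  segment (bary_point V1 V2 V3 p1 p2 p3) (bary_point V1 V2 V3 q1 q2 q3)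
    (bary_point V1 V2 V3 (w * p1 + (1 - w) * q1) (w * p2 + (1 - w) * q2)
                         (w * p3 + (1 - w) * q3)).
Proof.
move=> w01; have := segment_combination (bary_point V1 V2 V3 p1 p2 p3)
  (bary_point V1 V2 V3 q1 q2 q3) w01.
congr (segment _ _ _).
by rewrite /bary_point; apply/rowP => i; rewrite !mxE; ring.
Qed.

(** Moving the added term inside each minimum turns both exponents into
    [min (a12 + a21 - 2 a11) (a22 - a11)]. *)
Lemma expR_min_ratio (R : realType) (a11 a12 a21 a22 : R) :
  expR (a12 - a11) * expR (Num.min (a21 - a11) (a22 - a12)) =
  expR (a21 - a11) * expR (Num.min (a12 - a11) (a22 - a21)).
Proof.
rewrite -!expRD; congr expR; rewrite !minElt.
by case: ifP => h1; case: ifP => h2; lra.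
Qed.

Theorem theorem15 (R : realType) (A : 'M[R]_2)
    (n : nat) (V12 V21 V22 : 'rV[R]_n) :
  let a11 := A 0 0 in let a12 := A 0 1 in
  let a21 := A 1 0 in let a22 := A 1 1 in
  let alpha1 := Num.min (a12 - a11) (a22 - a21) in
  let alpha2 := Num.min (a21 - a11) (a22 - a12) in
  let point := bary_point V12 V21 V22 in
  let beta1 := point 0 0 1 in
  let beta2 := point (expR alpha1 / (expR alpha1 + 1)) 0
                     (1 / (expR alpha1 + 1)) in
  let beta3 := point 0 (expR alpha2 / (expR alpha2 + 1))
                     (1 / (expR alpha2 + 1)) in
  let beta4 :=
    point (expR (a12 - a11) / (expR (a12 - a11) + expR (a21 - a11)))
          (expR (a21 - a11) / (expR (a12 - a11) + expR (a21 - a11))) 0 in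
  a22 < a11 ->
  is_triangle V12 V21 V22 ->
  exists P : 'rV[R]_n,
    [/\ segment beta1 beta4 P, segment V21 beta2 P & segment V12 beta3 P].
Proof.
move=> a11 a12 a21 a22 alpha1 alpha2 point beta1 beta2 beta3 beta4 _ _.
have := expR_min_ratio a11 a12 a21 a22.
rewrite -/alpha1 -/alpha2 {}/beta2 {}/beta3 {}/beta4.
move: (expR_gt0 alpha1) (expR_gt0 alpha2).
move: (expR_gt0 (a12 - a11)) (expR_gt0 (a21 - a11)).
(* From here on the exponentials are arbitrary positive reals, tied together only by
   [u * q = v * p]. *)
move: (expR alpha1) (expR alpha2) (expR (a12 - a11)) (expR (a21 - a11)).
move=> p q u v u0 v0 p0 q0 uq_vp.
have s0 : 0 < p + q + 1 by lra.
have weight (x : R) : 0 <= x <= p + q + 1 -> 0 <= x / (p + q + 1) <= 1.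
  by move=> /andP[x0 xs]; rewrite ler_pdivrMr // mul1r xs divr_ge0 // ltW.
have V12E : point 1 0 0 = V12.
  by rewrite /point /bary_point scale1r !scale0r !addr0.
have V21E : point 0 1 0 = V21.
  by rewrite /point /bary_point scale1r !scale0r add0r addr0.
have [snz pnz qnz pqnz] :
    [/\ p + q + 1 != 0, p + 1 != 0, q + 1 != 0 & p + q != 0].
  by split; apply: lt0r_neq0; lra.
have uvnz : u + v != 0 by apply: lt0r_neq0; lra.
(* Since [u : v = p : q], the point [beta4] is [[p : q : 0]], the projection of [[p : q : 1]] from
   [V22] onto the opposite side. *)
have uE : u / (u + v) = p / (p + q).
  by apply/eqP; rewrite eqr_div //; apply/eqP; lra.
have vE : v / (u + v) = q / (p + q).
  by apply/eqP; rewrite eqr_div //; apply/eqP; lra.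
exists (point (p / (p + q + 1)) (q / (p + q + 1)) (1 / (p + q + 1))).
split.
(* On each segment, the far endpoint has coordinate 0 at the vertex where the segment starts. The
   weight of that vertex is therefore its own coordinate in the common point: [1], [q] and [p] over
   [p + q + 1] in the three cases. *)
- have := @segment_bary_point R n V12 V21 V22 (1 / (p + q + 1)) 0 0 1
    (u / (u + v)) (v / (u + v)) 0 (weight 1 ltac:(lra)).
  rewrite -/point uE vE; congr (segment _ _ _).
  by congr (point _ _ _); field; rewrite ?snz.
- have := @segment_bary_point R n V12 V21 V22 (q / (p + q + 1)) 0 1 0
    (p / (p + 1)) 0 (1 / (p + 1)) (weight q ltac:(lra)).
  rewrite -/point V21E; congr (segment _ _ _).
  by congr (point _ _ _); field; rewrite ?snz.
- have := @segment_bary_point R n V12 V21 V22 (p / (p + q + 1)) 1 0 0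
    0 (q / (q + 1)) (1 / (q + 1)) (weight p ltac:(lra)).
  rewrite -/point V12E; congr (segment _ _ _).
  by congr (point _ _ _); field; rewrite ?snz.
Qed.
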